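(* Let $G=\langle A\rangle\subset\mathrm{PGL}_3(\mathbb{C})$ be a cyclic group of order $n$, $1<n<+\infty$, generated by $A=\mathrm{diag}(1,\zeta_n^a,\zeta_n^b)$ for some integers $0\le a<b\le n-1$ with $\gcd(a,b)=1$. Then there exists a model for $G$ over $\mathbb{R}$ if and only if $n=2$, or $n>2$ and $a+b$, $a-2b$ or $2a-b$ equals $0 \bmod n$. In particular, any cyclic group generated by a homology of period $n\ge 3$ is pseudo-real. Furthermore, we can get a model for $G$ over $\mathbb{R}$ generated by $$\phi^{-1}A\,\phi=\begin{pmatrix} 2\,\mathrm{Im}(\alpha\overline{\beta}) & 0 & 0\\ 0 & 2\,\mathrm{Im}(\alpha\overline{\beta}\,\zeta_n^{a}) & 2|\beta|^2\sin(2\pi a/n)\\ 0 & -2|\alpha|^2\sin(2\pi a/n) & 2\,\mathrm{Im}(\alpha\overline{\beta}\,\zeta_n^{-a})\end{pmatrix}$$ for some $\alpha,\beta\in\mathbb{C}^*$ (and some $\phi\in\mathrm{PGL}_3(\mathbb{C})$).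
   Context: Here $\zeta_n=e^{2\pi i/n}$, and $\sigma$ is complex conjugation, acting entrywise on $\mathrm{PGL}_3(\mathbb{C})$; for a subgroup $G$ put ${}^{\sigma}G=\{{}^{\sigma}g: g\in G\}$. A matrix in $\mathrm{GL}_3(\mathbb{C})$ is identified with its class in $\mathrm{PGL}_3(\mathbb{C})$, and equalities of matrices are equalities in $\mathrm{PGL}_3(\mathbb{C})$. Up to $\mathrm{PGL}_3(\mathbb{C})$-conjugation, a finite nontrivial cyclic subgroup is taken to be generated by a diagonal element $A$ of the stated form. A homology of period $n$ is an element of $\mathrm{PGL}_3(\mathbb{C})$ conjugate to $\mathrm{diag}(1,1,\zeta_n)$. For a finite subgroup $G\subset\mathrm{PGL}_3(\mathbb{C})$: $G$ has a real field of moduli if ${}^{\sigma}G$ and $G$ are conjugate in $\mathrm{PGL}_3(\mathbb{C})$. $G$ is definable over $\mathbb{R}$ if it is $\mathrm{PGL}_3(\mathbb{C})$-conjugate to some $G'\subset\mathrm{PGL}_3(\mathbb{R})$; such a $G'$ is called a model for $G$ over $\mathbb{R}$. $G$ is pseudo-real if it has a real field of moduli but is not definable over $\mathbb{R}$.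
   Formalization: In the displayed model the exponent a (in ζ_n^a, ζ_n^{-a} and sin(2πa/n)) is replaced by b when a−2b = 0 mod n (this includes n=2); with exponent a the display is false there, e.g. for n=4, a=2, b=3. *)

(* Defs.v *)
From HB Require Import structures.
From mathcomp Require Import all_boot all_order all_algebra.
From mathcomp Require Import generic_quotient.
From mathcomp Require Import all_classical all_reals all_analysis.
From mathcomp Require Import complex.

Set Implicit Arguments.
Unset Strict Implicit.
Unset Printing Implicit Defensive.

Import Order.TTheory GRing.Theory Num.Theory.

Local Open Scope classical_set_scope.
Local Open Scope quotient_scope.
Local Open Scope complex_scope.
Local Open Scope ring_scope.

(* MathComp's {unit _} and {'GL_n[_]} require a finite ring. *)
Record GL (m : nat) (F : fieldType) :=
  MkGL { GLval :> 'M[F]_m; GLvalP : GLval \in unitmx }.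

HB.instance Definition _ m F := [isSub for @GLval m F].
HB.instance Definition _ m F := [Choice of GL m F by <:].

Section GeneralLinearGroup.
Variables (m : nat) (F : fieldType).
Implicit Types x y z : GL m F.

Definition GL1 : GL m F := MkGL (unitmx1 F m).

Definition GLmul x y : GL m F :=
  @MkGL m F (GLval x *m GLval y)
    (etrans (unitmx_mul _ _) (introT andP (conj (GLvalP x) (GLvalP y)))).

Definition GLinv x : GL m F :=
  @MkGL m F (invmx (GLval x)) (etrans (unitmx_inv _) (GLvalP x)).

Fact GLmulA : associative GLmul.
Proof. by move=> x y z; apply/val_inj; rewrite /= mulmxA. Qed.

Fact GLmul1l : left_id GL1 GLmul.
Proof. by move=> x; apply/val_inj; rewrite /= mul1mx. Qed.

Fact GLmul1r : right_id GL1 GLmul.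
Proof. by move=> x; apply/val_inj; rewrite /= mulmx1. Qed.

Fact GLmulVl : left_inverse GL1 GLinv GLmul.
Proof. by move=> x; apply/val_inj; rewrite /= mulVmx // GLvalP. Qed.

Fact GLmulVr : right_inverse GL1 GLinv GLmul.
Proof. by move=> x; apply/val_inj; rewrite /= mulmxV // GLvalP. Qed.

HB.instance Definition _ :=
  isGroup.Build (GL m F) GLmulA GLmul1l GLmul1r GLmulVl GLmulVr.

Definition GLscal_rel : rel (GL m F) :=
  fun x y => is_scalar_mx (GLval x *m invmx (GLval y)).

Lemma GLscal_relP x y :
  reflect (exists c : F, GLval x = c *: GLval y) (GLscal_rel x y).
Proof.
rewrite /GLscal_rel; apply: (iffP is_scalar_mxP) => -[c e]; exists c.
  by rewrite -[LHS](mulmxKV (GLvalP y)) e mul_scalar_mx.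
by rewrite e -scalemxAl mulmxV ?GLvalP // scalemx1.
Qed.

End GeneralLinearGroup.

Section ProjectiveLinearGroup.
Variables (m : nat) (F : fieldType).
Implicit Types x y z : GL m F.

Fact GLscal_refl : reflexive (@GLscal_rel m F).
Proof. by move=> x; apply/GLscal_relP; exists 1; rewrite scale1r. Qed.

Fact GLscal_sym : symmetric (@GLscal_rel m F).
Proof.
suff im x y : GLscal_rel x y -> GLscal_rel y x by move=> x y; apply/idP/idP; exact: im.
move=> /GLscal_relP[c e]; apply/GLscal_relP; exists c^-1.
have [c0|c_neq0] := eqVneq c 0; last by rewrite e scalerA mulVf // scale1r.
have x0 : GLval x = 0 by rewrite e c0 scale0r.
have xV := mulmxV (GLvalP x).
rewrite -[LHS]mulmx1 -[RHS]mulmx1 -xV x0 mul0mx.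
by rewrite !mulmx0.
Qed.

Fact GLscal_trans : transitive (@GLscal_rel m F).
Proof.
move=> y x z /GLscal_relP[c e] /GLscal_relP[d e']; apply/GLscal_relP.
by exists (c * d); rewrite e e' scalerA.
Qed.

Canonical GLscal_equiv := EquivRel (@GLscal_rel m F)
  GLscal_refl GLscal_sym GLscal_trans.

Definition PGL := {eq_quot GLscal_equiv}.

HB.instance Definition _ := Choice.on PGL.
HB.instance Definition _ := EqQuotient.on PGL.

Lemma PGL_eqP x y :
  reflect (exists c : F, GLval x = c *: GLval y) (\pi_PGL x == \pi_PGL y).
Proof. by rewrite eqmodE; exact: GLscal_relP. Qed.

Definition PGL1 : PGL := \pi_PGL 1%g.
Definition PGLmul (p q : PGL) : PGL := \pi_PGL (repr p * repr q)%g.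
Definition PGLinv (p : PGL) : PGL := \pi_PGL ((repr p)^-1)%g.

Lemma PGLW (P : PGL -> Prop) : (forall x, P (\pi_PGL x)) -> forall p, P p.
Proof. by move=> h p; rewrite -[p]reprK. Qed.

Lemma repr_piE x : exists c : F, GLval (repr (\pi_PGL x)) = c *: GLval x.
Proof. by apply/PGL_eqP; rewrite reprK. Qed.

Lemma PGLmul_pi x y : PGLmul (\pi_PGL x) (\pi_PGL y) = \pi_PGL (x * y)%g.
Proof.
have [c ec] := repr_piE x; have [d ed] := repr_piE y.
apply/eqP/PGL_eqP; exists (c * d).
by rewrite /= ec ed -scalemxAl -scalemxAr scalerA.
Qed.

Lemma PGLinv_pi x : PGLinv (\pi_PGL x) = \pi_PGL x^-1%g.
Proof.
apply/eqP/PGL_eqP.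
have /GLscal_relP[c e] : GLscal_rel x (repr (\pi_PGL x)).
  by rewrite GLscal_sym; apply/GLscal_relP; exact: repr_piE.
exists c.
rewrite /= -[LHS](mulmxK (GLvalP x)) [X in _ *m X *m _]e.
by rewrite -scalemxAr mulVmx ?GLvalP // -scalemxAl mul1mx.
Qed.

Fact PGLmulA : associative PGLmul.
Proof.
elim/PGLW=> x; elim/PGLW=> y; elim/PGLW=> z.
by rewrite !PGLmul_pi mulgA.
Qed.

Fact PGLmul1l : left_id PGL1 PGLmul.
Proof. by elim/PGLW=> x; rewrite PGLmul_pi mul1g. Qed.

Fact PGLmul1r : right_id PGL1 PGLmul.
Proof. by elim/PGLW=> x; rewrite PGLmul_pi mulg1. Qed.

Fact PGLmulVl : left_inverse PGL1 PGLinv PGLmul.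
Proof. by elim/PGLW=> x; rewrite PGLinv_pi PGLmul_pi mulVg. Qed.

Fact PGLmulVr : right_inverse PGL1 PGLinv PGLmul.
Proof. by elim/PGLW=> x; rewrite PGLinv_pi PGLmul_pi mulgV. Qed.

HB.instance Definition _ :=
  isGroup.Build PGL PGLmulA PGLmul1l PGLmul1r PGLmulVl PGLmulVr.

(* The class of M; junk value 1 if M is singular. *)
Definition pgl (M : 'M[F]_m) : PGL := \pi_PGL (insubd (1%g : GL m F) M).

End ProjectiveLinearGroup.

Section FieldMorphism.
Variables (m : nat) (F K : fieldType) (f : {rmorphism F -> K}).

Definition GLmap (x : GL m F) : GL m K :=
  @MkGL m K (map_mx f (GLval x)) (etrans (map_unitmx f _) (GLvalP x)).

Definition PGLmap (p : PGL m F) : PGL m K := \pi_(PGL m K) (GLmap (repr p)).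

Lemma PGLmap_pi x : PGLmap (\pi_(PGL m F) x) = \pi_(PGL m K) (GLmap x).
Proof.
have [c e] := repr_piE x.
by apply/eqP/PGL_eqP; exists (f c); rewrite /= e map_mxZ.
Qed.

Lemma PGLmap_pgl (M : 'M[F]_m) : PGLmap (pgl M) = pgl (map_mx f M).
Proof.
rewrite PGLmap_pi /pgl; congr (\pi_(PGL m K) _); apply/val_inj => /=.
rewrite !val_insubd map_unitmx; case: ifP => //= _; exact: map_mx1.
Qed.

End FieldMorphism.

Section Subgroups.
Variable gT : groupType.
Implicit Types (G : set gT) (x : gT).

Definition finite_subgroup G : Prop :=
  [/\ G 1%g, forall x y, G x -> G y -> G (x / y)%g & finite_set G].

Definition cyclic_subgroup x : set gT :=
  [set y | exists k : nat, (y = x ^+ k \/ y = x ^- k)%g].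

(* [x ^ y] is [y^-1 * (x * y)]. *)
Definition conjugates G (phi : gT) : set gT := [set (g ^ phi)%g | g in G].

Definition conjugate_subgroups G G' : Prop := exists phi, G' = conjugates G phi.

End Subgroups.

Section RealModels.
Variable R : realType.
Implicit Types G : set (PGL 3 R[i]).

Definition zeta (n : nat) : R[i] :=
  cos (2 * pi / n%:R) +i* sin (2 * pi / n%:R).

Definition diag3 (x y z : R[i]) : PGL 3 R[i] :=
  pgl (diag_mx (\row_(j < 3) [:: x; y; z]`_j)).

Definition PGL_of_real : PGL 3 R -> PGL 3 R[i] := PGLmap (real_complex R).

Definition PGL_conj : PGL 3 R[i] -> PGL 3 R[i] := PGLmap (@conjc R).

Definition real_field_of_moduli G : Prop :=
  conjugate_subgroups (PGL_conj @` G) G.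

Definition real_model G G' : Prop :=
  G' `<=` range PGL_of_real /\ conjugate_subgroups G G'.

Definition definable_over_R G : Prop := exists G', real_model G G'.

Definition pseudo_real G : Prop :=
  [/\ finite_subgroup G, real_field_of_moduli G & ~ definable_over_R G].

Definition homology (n : nat) (H : PGL 3 R[i]) : Prop :=
  exists phi, H = (diag3 1%R 1%R (zeta n) ^ phi)%g.

(* This is 2 * Im (alpha * beta^* ) times phi^-1 * diag (1, z, z^-1) * phi, where
   z = zeta n ^+ c and phi is block diagonal with blocks 1 and
   [[alpha, beta], [alpha^*, beta^* ]]; it is singular iff alpha * beta^* is
   real. *)
Definition model_mx (n c : nat) (alpha beta : R[i]) : 'M[R]_3 :=
  let s : R := sin (2 * pi * c%:R / n%:R) in
  let w : R[i] := alpha * conjc beta in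
  \matrix_(i < 3, j < 3) (nth [::]
    [:: [:: 2 * complex.Im w; 0; 0];
        [:: 0; 2 * complex.Im (w * zeta n ^+ c); 2 * complex.Re (`|beta| ^+ 2) * s];
        [:: 0; - 2 * complex.Re (`|alpha| ^+ 2) * s; 2 * complex.Im (w * zeta n ^- c)]] i)`_j.

End RealModels.

(* Main.v *)
Require Import Defs.
From HB Require Import structures.
From mathcomp Require Import all_boot all_order all_algebra generic_quotient.
From mathcomp Require Import all_classical all_reals all_analysis.
From mathcomp Require Import perm complex zify ring lra.

(** The cyclic group of a diagonal class A = diag(1, u, v) has a real model as
    soon as some conjugate of A is the class of a real matrix, and only then. Such
    a matrix is similar to r * diag(1, u, v) for some scalar r, and its
    eigenvalues r, r u, r v are permuted by complex conjugation
    ([conj_stable_spectrum]). As u and v have modulus one, dividing by r turns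
    this into an equality of multisets
    {s, s / u, s / v} = {1, u, v} with s = r^* / r.
    The six ways of matching the two sides leave
    u^2 = v^2 = 1, u v = 1, u = v^2 or v = u^2 ([eigenvalue_cases]); for powers
    of zeta_n these are congruences between exponents
    modulo n, and the first one forces n = 2 when the exponents are coprime.

    Conversely each congruence says that A is, up to a scalar and a
    permutation of the coordinates, diag(1, z, z^-1) with z a power of zeta_n
    ([diag3_permuted_spectrum]). In a frame whose last two rows are complex conjugate,
    conjugation exchanges the eigenvectors of z and z^-1 = z^* , so the matrix of
    that diagonal class is real: it is the stated one
    ([model_frame_eigen], [diag3_conj_model]). For n = 2 the only
    exponents are (0, 1), and a - 2 b = -2 = 0 mod 2, so that this case is
    covered by the same construction.

    Finally diag(1, 1, zeta_n) has exponents (0, 1), which satisfy none of the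
    congruences when n >= 3, while conjugation maps it to its inverse, which
    generates the same group: its group has a real field of moduli
    and no real model ([homology_pseudo_real]). *)

Import Order.TTheory GRing.Theory Num.Theory.

Set Implicit Arguments.
Unset Strict Implicit.
Unset Printing Implicit Defensive.

Local Open Scope classical_set_scope.
Local Open Scope quotient_scope.
Local Open Scope complex_scope.
Local Open Scope ring_scope.

(** * Cyclic subgroups *)

Lemma cyclic_subgroup_gen {gT : groupType} (x : gT) : cyclic_subgroup x x.
Proof. by exists 1%N; left; rewrite expg1. Qed.

Lemma image_cyclic_subgroup (gT hT : groupType) (f : UMagmaMorphism.type gT hT)
    (x : gT) : f @` cyclic_subgroup x = cyclic_subgroup (f x).
Proof.
apply/seteqP; split=> [_ [y [k yE] <-]|y [k yE]].
  by exists k; case: yE => ->; [left; exact: gmulfXn|right; exact: gmulfXVn].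
case: yE => ->; [exists (x ^+ k)%g|exists (x ^- k)%g].
- by exists k; left.
- exact: gmulfXn.
- by exists k; right.
- exact: gmulfXVn.
Qed.

Lemma conjugates_cyclic_subgroup {gT : groupType} (x p : gT) :
  conjugates (cyclic_subgroup x) p = cyclic_subgroup (x ^ p)%g.
Proof.
have conjF : {morph (fun y : gT => y ^ p) : y z / y / z}%g.
  by move=> y z; rewrite conjMg conjVg.
pose f : UMagmaMorphism.type gT gT :=
  HB.pack (fun y : gT => y ^ p)%g (isGroupMorphism.Build gT gT _ conjF).
exact: (image_cyclic_subgroup f).
Qed.

Lemma cyclic_subgroupV {gT : groupType} (x : gT) : cyclic_subgroup x^-1%g = cyclic_subgroup x.
Proof.
by apply/seteqP; split=> y [k [->|->]]; exists k;
  rewrite ?expVgn ?invgK; [right|left|right|left].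
Qed.

Lemma cyclic_subgroup_finite {gT : groupType} (x : gT) n : (0 < n)%N -> (x ^+ n = 1)%g ->
  finite_subgroup (cyclic_subgroup x).
Proof.
move=> n0 xn; have xmod k : (x ^+ k = x ^+ (k %% n))%g.
  by rewrite {1}(divn_eq k n) expgnDr mulnC expgnA xn expg1n mul1g.
have xV k : (x ^- k = x ^+ (n - k %% n))%g.
  by apply/mulg1_eq; rewrite [in LHS]xmod -expgnDr subnKC // ltnW // ltn_pmod.
have cycE y : cyclic_subgroup x y -> exists k, y = (x ^+ k)%g.
  by case=> k [->|->]; eexists; [|exact: xV].
split.
- by exists 0%N; left; rewrite expg0.
- move=> y z /cycE[i ->] /cycE[j ->]; exists (i + (n - j %% n))%N; left.
  by rewrite xV -expgnDr.
apply: (@sub_finite_set _ _ ((fun k => x ^+ k)%g @` `I_n)).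
  by move=> y /cycE[k ->]; exists (k %% n)%N; rewrite /= ?ltn_pmod // -xmod.
exact: finite_image.
Qed.

(** * Classes of matrices in the projective linear group *)

Section ProjectiveClasses.
Context {m : nat} {F K : fieldType}.

Fact PGLmap_divM (f : {rmorphism F -> K}) :
  {morph @PGLmap m F K f : x y / (x / y)%g}.
Proof.
elim/PGLW=> x; elim/PGLW=> y.
rewrite -[(_ / _)%g]/(PGLmul _ (PGLinv _)) PGLinv_pi PGLmul_pi !PGLmap_pi.
rewrite -[RHS]/(PGLmul _ (PGLinv _)) PGLinv_pi PGLmul_pi.
by congr (\pi_(PGL m K) _); apply: val_inj; rewrite /= map_mxM map_invmx.
Qed.

HB.instance Definition _ (f : {rmorphism F -> K}) :=
  isGroupMorphism.Build (PGL m F) (PGL m K) (PGLmap f) (PGLmap_divM f).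

Implicit Types M N P : 'M[F]_m.

Lemma pglP (p : PGL m F) : exists2 M, M \in unitmx & p = pgl M.
Proof.
elim/PGLW: p => x; exists (val x); first exact: (valP x).
rewrite /pgl; congr (\pi_(PGL m F) _); apply: val_inj.
by rewrite val_insubd (valP x).
Qed.

Lemma pgl_unit M (Mu : M \in unitmx) : pgl M = \pi_(PGL m F) (MkGL Mu).
Proof.
rewrite /pgl; congr (\pi_(PGL m F) _); apply: val_inj.
by rewrite val_insubd Mu.
Qed.

Lemma pglM M N : M \in unitmx -> N \in unitmx ->
  (pgl M * pgl N)%g = pgl (M *m N).
Proof.
move=> Mu Nu; rewrite -[LHS]/(PGLmul _ _) (pgl_unit Mu) (pgl_unit Nu) PGLmul_pi.
have MNu : M *m N \in unitmx by rewrite unitmx_mul Mu.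
by rewrite (pgl_unit MNu); congr (\pi_(PGL m F) _); apply: val_inj.
Qed.

Lemma pgl_eq M N : M \in unitmx -> N \in unitmx ->
  pgl M = pgl N <-> exists c, M = c *: N.
Proof.
move=> Mu Nu; rewrite (pgl_unit Mu) (pgl_unit Nu).
by split=> [/eqP/PGL_eqP//|cE]; apply/eqP/PGL_eqP.
Qed.

(** The scalar c is left free, so that an intertwining relation between
    matrices can be used without computing an inverse. *)
Lemma pgl_conj M N P : M \in unitmx -> N \in unitmx -> P \in unitmx ->
  (pgl M ^ pgl P)%g = pgl N <-> exists c, M *m P = c *: (P *m N).
Proof.
move=> Mu Nu Pu; have MPu : M *m P \in unitmx by rewrite unitmx_mul Mu.
have PNu : P *m N \in unitmx by rewrite unitmx_mul Pu.
rewrite -(pgl_eq MPu PNu) -!pglM // conjgE; split=> [<-|->]; last by rewrite mulKg.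
by rewrite mulVKg.
Qed.

End ProjectiveClasses.

(** * Spectra of real matrices *)

(** Over polynomials, ('X - M) P = P ('X - N), and det P can be cancelled. *)
Lemma char_poly_intertwine (F : fieldType) (n : nat) (P M N : 'M[F]_n) :
  P \in unitmx -> M *m P = P *m N -> char_poly M = char_poly N.
Proof.
move=> Pu MP; pose Q : 'M[{poly F}]_n := map_mx polyC P.
have Qu : \det Q != 0.
  by rewrite det_map_mx polyC_eq0 -unitfE -unitmxE.
apply: (mulIf Qu); rewrite /char_poly -det_mulmx [RHS]mulrC -det_mulmx; congr (\det _).
by rewrite /char_poly_mx mulmxBl mulmxBr scalar_mxC -!map_mxM MP.
Qed.

(** The characteristic polynomial of M has real coefficients, so conjugating its
    roots gives back the same polynomial; a split polynomial determines its
    roots with multiplicity. *)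
Lemma conj_stable_spectrum (R : realType) (n : nat) (d : 'I_n -> R[i])
    (M : 'M[R]_n) (P : 'M[R[i]]_n) :
  P \in unitmx ->
  diag_mx (\row_j d j) *m P = P *m map_mx (real_complex R) M ->
  perm_eq [seq conjc (d i) | i <- enum 'I_n] [seq d i | i <- enum 'I_n].
Proof.
move=> Pu DP; have dE : char_poly (map_mx (real_complex R) M) = \prod_i ('X - (d i)%:P).
  rewrite -(char_poly_intertwine Pu DP) (char_poly_trig (diag_mx_is_trig _)).
  by apply: eq_bigr => i _; rewrite !mxE eqxx.
apply: prod_XsubC_eq; rewrite !big_map -dE.
transitivity (map_poly (@conjc R) (\prod_i ('X - (d i)%:P))).
  rewrite rmorph_prod; apply: eq_bigr => i _.
  by rewrite rmorphB /= map_polyX map_polyC.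
rewrite -dE map_char_poly -map_mx_comp; congr char_poly.
by apply/matrixP => i j; rewrite !mxE /= oppr0.
Qed.

(** * The root of unity zeta *)

Section RootOfUnity.
Variables (R : realType) (n : nat).
Hypothesis n_gt0 : (0 < n)%N.
Local Notation z := (zeta R n).

Let n_neq0 : n%:R != 0 :> R. Proof. by rewrite pnatr_eq0 -lt0n. Qed.

Lemma zetaX k :
  z ^+ k = cos (2 * pi * k%:R / n%:R) +i* sin (2 * pi * k%:R / n%:R).
Proof.
elim: k => [|k IHk]; first by rewrite expr0 mulr0 mul0r cos0 sin0.
have -> : 2 * pi * k.+1%:R / n%:R = 2 * pi / n%:R + 2 * pi * k%:R / n%:R :> R.
  by rewrite -addn1 natrD; field.
by rewrite exprS IHk cosD sinD; apply/eqP; rewrite eq_complex /= [X in _ && (_ == X)]addrC !eqxx.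
Qed.

Lemma zeta_mul_conjc : z * conjc z = 1.
Proof.
apply/eqP; rewrite eq_complex /= mulrN opprK -!expr2 cos2Dsin2 eqxx /=.
by rewrite mulrN mulrC addNr.
Qed.

Lemma zeta_neq0 : z != 0.
Proof.
by apply/eqP => z0; have /eqP := zeta_mul_conjc; rewrite z0 mul0r eq_sym oner_eq0.
Qed.

Lemma conjc_zetaX k : conjc (z ^+ k) = z ^- k.
Proof.
rewrite rmorphXn -exprVn; congr (_ ^+ k).
by apply: (mulfI zeta_neq0); rewrite divff ?zeta_neq0 ?zeta_mul_conjc.
Qed.

(** An equality zeta^k = 1 with 0 < k < n would give cos (2 t) = 1 with
    t = k pi / n strictly between 0 and pi, whereas cos (2 t) = 1 - 2 sin^2 t
    and sin t > 0 there. *)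
Lemma zeta_prim : n.-primitive_root z.
Proof.
rewrite /primitive_root_of_unity n_gt0; apply/forallP => -[k /= kn].
rewrite unity_rootE zetaX.
have [->|k_neq] := eqVneq k.+1 n.
  by rewrite mulfK // mulr_natl cos2pi sin2pi eqxx.
have pi0 := @pi_gt0 R.
have half_gt0 : 0 < sin (pi * (k.+1%:R / n%:R)) :> R.
  apply: sin_gt0_pi; rewrite mulr_gt0 ?divr_gt0 ?ltr0n //=.
  by rewrite gtr_pMr // ltr_pdivrMr ?ltr0n // mul1r ltr_nat ltn_neqAle k_neq.
apply/eqP/negbTE/eqP => -[cos1 _].
have E : 2 * pi * k.+1%:R / n%:R = (pi * (k.+1%:R / n%:R)) *+ 2 :> R.
  by rewrite mulr2n; field.
move: cos1; rewrite E cos_mulr2n cos2sin2 => cos1.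
have : sin (pi * (k.+1%:R / n%:R)) ^+ 2 = 0 :> R by lra.
by move=> /eqP; rewrite sqrf_eq0 gt_eqF.
Qed.

Lemma zeta_expz_eq1 (k : int) : z ^ k = 1 <-> (k = 0 %[mod n])%Z.
Proof.
suff -> : (k = 0 %[mod n])%Z <-> (n %| `|k|)%N.
  rewrite (prim_order_dvd zeta_prim).
  case: k => k /=; first by split=> /eqP.
  rewrite NegzE -invr_expz; split=> [/(congr1 GRing.inv)|/eqP h].
    by rewrite invrK invr1 => /eqP.
  by rewrite -[RHS]invr1; congr (_^-1).
split=> [/eqP|]; first by rewrite eqz_mod_dvd subr0 dvdzE.
by move=> h; apply/eqP; rewrite eqz_mod_dvd subr0 dvdzE.
Qed.

End RootOfUnity.

(** * Matching the eigenvalues with their conjugates *)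

Lemma perm_eq2 (T : eqType) (x y p q : T) :
  perm_eq [:: x; y] [:: p; q] -> x = p /\ y = q \/ x = q /\ y = p.
Proof.
move=> pe; have := perm_mem pe x; rewrite !inE eqxx /= => /esym/orP[]/eqP xE.
  by left; move: pe; rewrite xE perm_cons => /perm_small_eq -/(_ isT)[].
right; move: pe; rewrite xE perm_sym (perm_catC [:: p] [:: q]) perm_cons perm_sym.
by move=> /perm_small_eq -/(_ isT)[].
Qed.

(** A bijection between the two lists sends the first entry r to 1, u or v; in
    each case one more matched entry gives the relation. The cyclic
    matchings would give v = 1 or u = v, and are excluded. *)
Lemma eigenvalue_cases (F : fieldType) (r u v : F) :
  u != 0 -> v != 0 -> v != 1 -> u != v ->
  perm_eq [:: r; r / u; r / v] [:: 1; u; v] ->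
  [\/ u ^+ 2 = 1 /\ v ^+ 2 = 1, u * v = 1, u = v ^+ 2 | v = u ^+ 2].
Proof.
move=> u0 v0 /eqP v1 /eqP uv pe.
have divE (x y w : F) : y != 0 -> x / y = w -> x = w * y by move=> y0 <-; rewrite divfK.
have : r \in [:: 1; u; v] by rewrite -(perm_mem pe) inE eqxx.
rewrite !inE => /or3P[]/eqP rE.
- move: pe; rewrite rE perm_cons => /perm_eq2[].
    by move=> [/(divE _ _ _ u0) uE /(divE _ _ _ v0) vE]; constructor 1.
  by move=> [/(divE _ _ _ u0) vuE _]; constructor 2; rewrite mulrC.
- move: pe; rewrite rE (perm_sym _ [:: 1; u; v]) (perm_catCA [:: 1] [:: u] [:: v]).
  rewrite perm_cons perm_sym => /perm_eq2[].
    by move=> [_ /(divE _ _ _ v0)]; constructor 3.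
  by move=> [/(divE _ _ _ u0)]; rewrite -[LHS]mul1r => /(mulIf u0)/esym.
- move: pe; rewrite rE (perm_sym _ [:: 1; u; v]) (perm_catC [:: 1; u] [:: v]).
  rewrite perm_cons perm_sym => /perm_eq2[].
    by move=> [/(divE _ _ _ u0)]; rewrite mul1r => /esym.
  by move=> [/(divE _ _ _ u0)]; constructor 4.
Qed.

(** * Diagonal classes *)

Section Diagonal.
Variable R : realType.

Lemma diag3_mx_unit (x y t : R[i]) : x != 0 -> y != 0 -> t != 0 ->
  diag_mx (\row_(j < 3) [:: x; y; t]`_j) \in unitmx.
Proof.
move=> x0 y0 t0; rewrite unitmxE unitfE det_diag !big_ord_recl big_ord0 !mxE /=.
by rewrite !mulf_neq0 ?oner_eq0.
Qed.

Lemma diag3M (x y t x' y' t' : R[i]) :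
  x != 0 -> y != 0 -> t != 0 -> x' != 0 -> y' != 0 -> t' != 0 ->
  (diag3 x y t * diag3 x' y' t')%g = diag3 (x * x') (y * y') (t * t').
Proof.
move=> x0 y0 t0 x'0 y'0 t'0; rewrite /diag3 pglM ?diag3_mx_unit //; congr (pgl _).
rewrite mulmx_diag; congr (diag_mx _); apply/rowP => -[[|[|[|//]]] ?];
  by rewrite !mxE.
Qed.

Lemma diag3_111 : diag3 1 1 1 = 1%g :> PGL 3 R[i].
Proof.
rewrite /diag3 (_ : diag_mx _ = 1%:M).
  rewrite (pgl_unit (unitmx1 _ _)) -[RHS]/(PGL1 _ _) /PGL1.
  by congr (\pi_(PGL 3 R[i]) _); apply: val_inj.
by apply/matrixP => i j; rewrite !mxE; case: i => -[|[|[|//]]].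
Qed.

Lemma diag3X (x : R[i]) k : x != 0 -> (diag3 1%R 1%R x ^+ k)%g = diag3 1 1 (x ^+ k).
Proof.
move=> x0; elim: k => [|k IHk]; first by rewrite expg0 expr0 diag3_111.
by rewrite expgS IHk diag3M ?oner_eq0 ?expf_neq0 // !mul1r exprS.
Qed.

End Diagonal.

(** * The real model *)

Section Model.
Variables (R : realType) (n c : nat) (alpha beta : R[i]).
Hypothesis n_gt0 : (0 < n)%N.

Local Notation w := (alpha * conjc beta).
Local Notation k := ((2 * complex.Im w)%:C).
Local Notation spec := [:: 1; zeta R n ^+ c; zeta R n ^- c].

(** The last two rows are complex conjugate: they are eigenvectors of the real
    model for the conjugate eigenvalues z and z^-1. *)
Definition model_frame : 'M[R[i]]_3 :=
  \matrix_(i < 3, j < 3) (nth [::]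
    [:: [:: 1; 0; 0];
        [:: 0; alpha; beta];
        [:: 0; conjc alpha; conjc beta]] i)`_j.

(** Multiplying by the frame, rather than conjugating by it, makes the identity
    polynomial in the real and imaginary parts of alpha, beta and zeta ^ c. *)
Lemma model_frame_eigen :
  model_frame *m map_mx (real_complex R) (model_mx n c alpha beta) =
  k *: (diag_mx (\row_j spec`_j) *m model_frame).
Proof.
have normE (x : R[i]) : complex.Re (`|x| ^+ 2) = complex.Re x ^+ 2 + complex.Im x ^+ 2.
  by rewrite sqr_normc; case: x => x y /=; ring.
have zcE := zetaX R n_gt0 c; have := conjc_zetaX R n c; rewrite {1}zcE /= => zNE.
apply/matrixP => i j; rewrite !mxE !big_ord_recl !big_ord0 !mxE.
rewrite /model_mx /model_frame -zNE zcE !normE.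
move: (cos _) (sin _) => C S; case: (alpha) (beta) => a1 a2 [b1 b2].
case: i j => -[|[|[|//]]] ? -[[|[|[|//]]] ?];
  by apply/eqP; rewrite eq_complex /=; apply/andP; split; apply/eqP; rewrite /=; ring.
Qed.

Hypothesis w_nonreal : complex.Im w != 0.

Lemma model_frame_unit : model_frame \in unitmx.
Proof.
rewrite unitmxE unitfE (expand_det_row _ ord0) !big_ord_recl big_ord0 !mxE /=.
rewrite !mul0r !addr0 mul1r /cofactor /= mul1r (expand_det_row _ ord0).
rewrite !big_ord_recl big_ord0 !mxE /= /cofactor !det_mx11 !mxE /=.
apply/negP; rewrite eq_complex => /andP[_ /eqP] /=; move: w_nonreal.
case: (alpha) (beta) => a1 a2 [b1 b2] /= /eqP wn; apply: contra_not wn => h.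
by lra.
Qed.

Let spec_unit : diag_mx (\row_(j < 3) spec`_j) \in unitmx.
Proof.
by apply: diag3_mx_unit; rewrite ?oner_eq0 ?invr_eq0 // expf_neq0 // zeta_neq0.
Qed.

Let k_neq0 : k != 0 :> R[i].
Proof. by rewrite fmorph_eq0 mulf_neq0 // pnatr_eq0. Qed.

Lemma model_mx_unit : model_mx n c alpha beta \in unitmx.
Proof.
rewrite -(map_unitmx (real_complex R)).
have: model_frame *m map_mx (real_complex R) (model_mx n c alpha beta) \in unitmx.
  by rewrite model_frame_eigen unitmxZ ?unitfE // unitmx_mul spec_unit model_frame_unit.
by rewrite unitmx_mul => /andP[].
Qed.

(** Reordering the rows of the frame by s reorders the eigenvalues, and the
    scalar l is invisible projectively. *)
Lemma diag3_conj_model (s : 'S_3) (l x y t : R[i]) : l != 0 ->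
  (forall i : 'I_3, [:: x; y; t]`_i = l * spec`_(s i)) ->
  (diag3 x y t ^ pgl (row_perm s model_frame))%g =
  PGL_of_real (pgl (model_mx n c alpha beta)).
Proof.
move=> l0 dE; rewrite /PGL_of_real PGLmap_pgl.
have DE : diag_mx (\row_(j < 3) [:: x; y; t]`_j) *m row_perm s model_frame =
    l *: row_perm s (diag_mx (\row_j spec`_j) *m model_frame).
  apply/matrixP => i j; rewrite !mul_diag_mx !mxE mulrA.
  by congr (_ * _); exact: dE.
have frame_u : row_perm s model_frame \in unitmx.
  by rewrite row_permE unitmx_mul unitmx_perm model_frame_unit.
have Du : diag_mx (\row_(j < 3) [:: x; y; t]`_j) \in unitmx.
  suff: diag_mx (\row_(j < 3) [:: x; y; t]`_j) *m row_perm s model_frame \in unitmx.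
    by rewrite unitmx_mul => /andP[].
  rewrite DE unitmxZ ?unitfE // row_permE !unitmx_mul unitmx_perm.
  by rewrite spec_unit model_frame_unit.
have Mu : map_mx (real_complex R) (model_mx n c alpha beta) \in unitmx.
  by rewrite map_unitmx model_mx_unit.
apply/(pgl_conj Du Mu frame_u).
(* k = 2 Im w is the scalar of model_frame_eigen *)
exists (l / k); rewrite DE !row_permE -mulmxA model_frame_eigen.
by rewrite -scalemxAr scalerA divfK.
Qed.

End Model.

(** * Groups with a real model *)

Section RealModels.
Variable R : realType.

Lemma real_model_cyclic (A : PGL 3 R[i]) phi X :
  (A ^ phi)%g = PGL_of_real X ->
  real_model (cyclic_subgroup A) (cyclic_subgroup (A ^ phi)%g).
Proof.
move=> AX; split; last by exists phi; rewrite conjugates_cyclic_subgroup.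
rewrite AX -(image_cyclic_subgroup (PGLmap (real_complex R))).
exact: image_subset.
Qed.

Lemma real_model_gen (A : PGL 3 R[i]) G' : real_model (cyclic_subgroup A) G' ->
  exists phi X, (A ^ phi)%g = PGL_of_real X.
Proof.
move=> [GR [phi GE]].
have [|X _ XE] := GR (A ^ phi)%g; last by exists phi, X; rewrite XE.
by rewrite GE conjugates_cyclic_subgroup; exact: cyclic_subgroup_gen.
Qed.

(** Conjugation inverts numbers of modulus one, so it sends the eigenvalues
    r, r u, r v of a real matrix to r^*, r^* / u, r^* / v. *)
Lemma diag3_real_cases (u v : R[i]) phi X :
  u * conjc u = 1 -> v * conjc v = 1 -> v != 1 -> u != v ->
  (diag3 1%R u v ^ phi)%g = PGL_of_real X ->
  [\/ u ^+ 2 = 1 /\ v ^+ 2 = 1, u * v = 1, u = v ^+ 2 | v = u ^+ 2].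
Proof.
have norm1 (x : R[i]) : x * conjc x = 1 -> x != 0 /\ conjc x = x^-1.
  move=> xx; have x0 : x != 0.
    by apply/eqP => x0; have /eqP := xx; rewrite x0 mul0r eq_sym oner_eq0.
  by split=> //; apply: (mulfI x0); rewrite divff.
move=> /norm1[u0 uC] /norm1[v0 vC] v1 uv.
have [P Pu ->] := pglP phi; have [M Mu ->] := pglP X.
have Du := diag3_mx_unit (oner_neq0 R[i]) u0 v0.
rewrite /PGL_of_real PGLmap_pgl => DP.
have MCu : map_mx (real_complex R) M \in unitmx by rewrite map_unitmx.
have {}DP := (pgl_conj Du MCu Pu).1 DP; move: DP => [c DP].
have c0 : c != 0.
  apply/eqP => c0; have : diag_mx (\row_(j < 3) [:: 1; u; v]`_j) *m P \in unitmx.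
    by rewrite unitmx_mul Du.
  by rewrite DP c0 scale0r unitmxE det0 unitr0.
have : perm_eq [seq conjc (c^-1 * [:: 1; u; v]`_i) | i : 'I_3 <- enum 'I_3]
               [seq c^-1 * [:: 1; u; v]`_i | i : 'I_3 <- enum 'I_3].
  apply: (@conj_stable_spectrum _ _ _ M P) => //.
  have -> : diag_mx (\row_(j < 3) (c^-1 * [:: 1; u; v]`_j)) =
      c^-1 *: diag_mx (\row_(j < 3) [:: 1; u; v]`_j).
    by apply/matrixP => i j; rewrite !mxE mulrnAr.
  by rewrite -scalemxAl DP scalerA mulVf // scale1r.
(* multiplying by c makes the second list [:: 1; u; v] *)
rewrite !enum_ordSl enum_ord0 /= => /(perm_map ( *%R c)) /=.
rewrite !rmorphM rmorph1 /= uC vC !mulr1 !mulrA !mulfV // !mul1r.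
exact: eigenvalue_cases.
Qed.

(** The relation u^2 = v^2 = 1 means that n divides 2 a and 2 b, hence
    2 gcd(a, b) = 2; each of the other three relations is a congruence. *)
Lemma real_model_cases n a b G' :
  (1 < n)%N -> (a < b)%N -> (b <= n - 1)%N -> gcdn a b = 1%N ->
  real_model (cyclic_subgroup (diag3 1 (zeta R n ^+ a) (zeta R n ^+ b))) G' ->
  n = 2%N \/
  (2 < n)%N /\
    [\/ (a%:Z + b%:Z = 0 %[mod n])%Z,
        (a%:Z - 2 * b%:Z = 0 %[mod n])%Z |
        (2 * a%:Z - b%:Z = 0 %[mod n])%Z].
Proof.
move=> n1 ab bn coab /real_model_gen[phi [X DX]].
have n0 : (0 < n)%N by apply: ltnW.
have bltn : (b < n)%N by lia.
have prim := zeta_prim R n0.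
have z0 := zeta_neq0 R n; have zX0 k : zeta R n ^+ k != 0 by rewrite expf_neq0.
have zXJ k : zeta R n ^+ k * conjc (zeta R n ^+ k) = 1 by rewrite conjc_zetaX divff.
have zb_neq1 : zeta R n ^+ b != 1.
  by rewrite -(prim_order_dvd prim); apply/negP => /dvdn_leq; lia.
have za_neq_zb : zeta R n ^+ a != zeta R n ^+ b.
  by rewrite (eq_prim_root_expr prim) !modn_small ?neq_ltn ?ab //; lia.
case: (diag3_real_cases (zXJ a) (zXJ b) zb_neq1 za_neq_zb DX).
- move=> [/eqP + /eqP]; rewrite -!exprM -!(prim_order_dvd prim) => na nb.
  have : (n %| gcdn a b * 2)%N by rewrite muln_gcdl dvdn_gcd na.
  by rewrite coab => /dvdn_leq; left; lia.
all: move=> zE; have [->|n2] := eqVneq n 2%N; [by left|right; split; first by lia].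
- constructor 1; apply/(zeta_expz_eq1 R n0).
  by rewrite expfzDr // -!exprnP zE.
- constructor 2; apply/(zeta_expz_eq1 R n0).
  by rewrite expfzDr // -invr_expz -[2 * _]/((2 * b)%:Z) -!exprnP zE -exprM mulnC divff.
- constructor 3; apply/(zeta_expz_eq1 R n0).
  by rewrite expfzDr // -invr_expz -[2 * _]/((2 * a)%:Z) -!exprnP zE -exprM mulnC divff.
Qed.

End RealModels.

(** With z = zeta ^ c, the diagonal matrix is one of diag(1, z, z^-1),
    diag(1, z, z^2) = z diag(z^-1, 1, z) and
    diag(1, z^2, z) = z diag(z^-1, z, 1). *)
Lemma diag3_permuted_spectrum (R : realType) n a b c : (0 < n)%N ->
  c = a /\ ((a%:Z + b%:Z = 0 %[mod n])%Z \/
            (2 * a%:Z - b%:Z = 0 %[mod n])%Z) \/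
  c = b /\ (a%:Z - 2 * b%:Z = 0 %[mod n])%Z ->
  exists (s : 'S_3) (l : R[i]), l != 0 /\ forall i : 'I_3,
    [:: 1; zeta R n ^+ a; zeta R n ^+ b]`_i =
    l * [:: 1; zeta R n ^+ c; zeta R n ^- c]`_(s i).
Proof.
move=> n0; have z0 := zeta_neq0 R n; have zX0 k : zeta R n ^+ k != 0 by rewrite expf_neq0.
have [lt0 lt1 lt2] : [/\ (0 < 3)%N, (1 < 3)%N & (2 < 3)%N] by [].
pose i0 := Ordinal lt0; pose i1 := Ordinal lt1; pose i2 := Ordinal lt2.
case=> [[->]|[->]].
- case=> /(zeta_expz_eq1 R n0); rewrite expfzDr //.
    rewrite -!exprnP => zE; exists 1%g, 1; split; first exact: oner_neq0.
    have zbE : zeta R n ^+ b = zeta R n ^- a by apply: (mulfI (zX0 a)); rewrite divff.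
    by move=> i; rewrite perm1 mul1r zbE.
  rewrite -invr_expz -[2 * _]/((2 * a)%:Z) -!exprnP => zE.
  have zbE : zeta R n ^+ b = zeta R n ^+ a * zeta R n ^+ a.
    by rewrite -exprD addnn -mul2n; apply: (mulIf (invr_neq0 (zX0 b))); rewrite divff.
  (* the cycle 0 -> 2 -> 1 -> 0 *)
  exists (tperm i0 i1 * tperm i1 i2)%g, (zeta R n ^+ a); split=> // -[[|[|[|//]]] ?];
    rewrite permM !permE /= ?permE /= ?mulr1 ?divff //.
move=> /(zeta_expz_eq1 R n0); rewrite expfzDr // -invr_expz.
rewrite -[2 * _]/((2 * b)%:Z) -!exprnP => zE.
have zaE : zeta R n ^+ a = zeta R n ^+ b * zeta R n ^+ b.
  rewrite -exprD addnn -mul2n; apply: (mulIf (invr_neq0 (zX0 (2 * b)%N))).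
  by rewrite divff.
exists (tperm i0 i2), (zeta R n ^+ b); split=> // -[[|[|[|//]]] ?];
  rewrite !permE /= ?mulr1 ?divff //.
Qed.

(** * Homologies *)

(** Conjugation maps D = diag(1, 1, zeta) to its inverse, hence preserves the
    group that D generates; a conjugate D ^ phi is then carried to a conjugate of
    the same group by the conjugate of phi. *)
Lemma homology_pseudo_real (R : realType) n (H : PGL 3 R[i]) :
  (3 <= n)%N -> homology n H -> pseudo_real (cyclic_subgroup H).
Proof.
move=> n3 [phi HE]; have n0 : (0 < n)%N by lia.
have z0 := zeta_neq0 R n; pose D : PGL 3 R[i] := diag3 1 1 (zeta R n).
split.
- apply: (@cyclic_subgroup_finite _ _ n) => //.
  have Dn : (D ^+ n)%g = 1%g.
    by rewrite diag3X // (prim_expr_order (zeta_prim R n0)); exact: diag3_111.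
  by rewrite HE -(conjXg D) Dn conj1g.
- have conjD : PGL_conj D = D^-1%g.
    rewrite /PGL_conj {1}/D /diag3 PGLmap_pgl.
    have -> : map_mx (@conjc R) (diag_mx (\row_(j < 3) [:: 1; 1; zeta R n]`_j)) =
        diag_mx (\row_(j < 3) [:: 1; 1; (zeta R n)^-1]`_j).
      have := conjc_zetaX R n 1; rewrite !expr1 => zJ.
      apply/matrixP => i j; rewrite !mxE rmorphMn; congr (_ *+ _).
      by case: i => -[|[|[|//]]] ?; [exact: rmorph1|exact: rmorph1|exact: zJ].
    rewrite -/(diag3 1 1 (zeta R n)^-1); apply/esym/mulg1_eq.
    by rewrite diag3M ?oner_eq0 ?invr_eq0 // divff // !mul1r diag3_111.
  pose psi := PGL_conj phi; exists (psi^-1 * phi)%g.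
  have -> : @PGL_conj R @` cyclic_subgroup H = cyclic_subgroup (PGL_conj H).
    exact: (image_cyclic_subgroup (PGLmap (@conjc R))).
  have -> : PGL_conj H = ((D ^ psi)^-1)%g.
    have conjJ : {morph @PGL_conj R : x y / (x ^ y)%g}.
      exact: (gmulfJ (PGLmap (@conjc R))).
    by rewrite HE conjJ conjD conjVg.
  have conj_back (x p q : PGL 3 R[i]) : ((x ^ p) ^ (p^-1 * q) = x ^ q)%g.
    by rewrite conjgM conjgK.
  by rewrite cyclic_subgroupV conjugates_cyclic_subgroup conj_back HE.
move=> [G' [GR [psi GE]]].
have GD : real_model (cyclic_subgroup (diag3 1 (zeta R n ^+ 0) (zeta R n ^+ 1))) G'.
  split; first exact: GR.
  exists (phi * psi)%g; rewrite expr0 expr1 GE HE.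
  rewrite [LHS]conjugates_cyclic_subgroup [RHS]conjugates_cyclic_subgroup.
  by rewrite conjgM.
have n_gt1 : (1 < n)%N by lia.
have n1_gt0 : (1 <= n - 1)%N by lia.
have [|] := real_model_cases n_gt1 (ltn0Sn 0) n1_gt0 (gcd0n 1) GD; first by lia.
by move=> [_ [] /eqP]; rewrite eqz_mod_dvd dvdzE => /dvdn_leq -/(_ isT) /=; lia.
Qed.

(** * Classification and models *)

Theorem theorem2p2 (R : realType) :
  (forall n a b : nat, (1 < n)%N -> (a < b)%N -> (b <= n - 1)%N ->
     gcdn a b = 1%N ->
     let A : PGL 3 R[i] := diag3 1 (zeta R n ^+ a) (zeta R n ^+ b) in
     let G := cyclic_subgroup A in
     (G #= `I_n)%card ->
     ((exists G', real_model G G') <->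
        n = 2%N \/
        (2 < n)%N /\
          [\/ (a%:Z + b%:Z = 0 %[mod n])%Z,
              (a%:Z - 2 * b%:Z = 0 %[mod n])%Z |
              (2 * a%:Z - b%:Z = 0 %[mod n])%Z])
     /\
     (forall c : nat,
        c = a /\ ((a%:Z + b%:Z = 0 %[mod n])%Z \/
                  (2 * a%:Z - b%:Z = 0 %[mod n])%Z) \/
        c = b /\ (a%:Z - 2 * b%:Z = 0 %[mod n])%Z ->
        exists (alpha beta : R[i]) (phi : PGL 3 R[i]),
          [/\ alpha != 0, beta != 0,
              model_mx n c alpha beta \in unitmx,
              (phi^-1 * A * phi)%g = PGL_of_real (pgl (model_mx n c alpha beta)) &
              real_model G (cyclic_subgroup (phi^-1 * A * phi)%g)]))
  /\
  (forall (n : nat) (H : PGL 3 R[i]), (3 <= n)%N -> homology n H ->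
     pseudo_real (cyclic_subgroup H)).
Proof.
split=> [n a b n1 ab bn coab A G _|n H]; last exact: homology_pseudo_real.
have n0 : (0 < n)%N by apply: ltnW.
have model c : c = a /\ ((a%:Z + b%:Z = 0 %[mod n])%Z \/
                  (2 * a%:Z - b%:Z = 0 %[mod n])%Z) \/
               c = b /\ (a%:Z - 2 * b%:Z = 0 %[mod n])%Z ->
    exists (alpha beta : R[i]) (phi : PGL 3 R[i]),
      [/\ alpha != 0, beta != 0,
          model_mx n c alpha beta \in unitmx,
          (phi^-1 * A * phi)%g = PGL_of_real (pgl (model_mx n c alpha beta)) &
          real_model G (cyclic_subgroup (phi^-1 * A * phi)%g)].
  move=> /(diag3_permuted_spectrum R n0)[s [l [l0 AE]]].
  (* any alpha and beta with alpha * beta^* not real would do *)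
  pose i : R[i] := 0 +i* 1.
  have w_nonreal : complex.Im (1 * conjc i) != 0.
    by rewrite mul1r /= oppr_eq0 oner_eq0.
  pose phi := pgl (row_perm s (model_frame 1 i)).
  have AphiE : (phi^-1 * A * phi)%g = (A ^ phi)%g by rewrite conjgE mulgA.
  have Aphi := diag3_conj_model n0 w_nonreal l0 AE.
  exists 1, i, phi; rewrite AphiE; split; [| | | exact: Aphi |].
  - exact: oner_neq0.
  - by rewrite eq_complex /= oner_eq0 andbF.
  - exact: model_mx_unit.
  - exact: real_model_cyclic Aphi.
split=> //; split=> [[G' ]|cond]; first exact: real_model_cases.
suff [c cP] : exists c : nat, c = a /\ ((a%:Z + b%:Z = 0 %[mod n])%Z \/
                  (2 * a%:Z - b%:Z = 0 %[mod n])%Z) \/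
               c = b /\ (a%:Z - 2 * b%:Z = 0 %[mod n])%Z.
  by have [al [be [phi [_ _ _ _ rm]]]] := model c cP; eexists; exact: rm.
case: cond => [n2|[_ [h|h|h]]]; last 3 first.
- by exists a; left; split=> //; left.
- by exists b; right.
- by exists a; left; split=> //; right.
(* n = 2 leaves only a = 0 and b = 1 *)
exists b; right; split=> //; apply/eqP; rewrite eqz_mod_dvd.
have [-> ->] : a = 0%N /\ b = 1%N by lia.
by rewrite n2.
Qed.
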